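(* Let $(C_0,C,\Gamma_1,\Gamma_2)$ be an associative BD-structure on a completely ordered finite set $S$, with $N=|S|$. This structure (together with the complete order) is obtained, up to isomorphism of completely ordered sets with associative BD-structure, by the matrix construction described in the context from some integer $N\times n$-matrix $(m^j_i)$ satisfying conditions (a) and (b) of the context (for some $n$) if and only if $\alpha_0\notin\Gamma_2$ and $C=C_0^k$ for some $k\in\mathbb{Z}$ (relatively prime to $N=|S|$).
   Context: A transitive cyclic permutation of a finite set $S$ is one acting as a single $|S|$-cycle; $\Gamma_{C_0}=\{(s,C_0(s)): s\in S\}$. An associative BD-structure on $S$ is $(C_0,C,\Gamma_1,\Gamma_2)$, with $C_0,C$ transitive cyclic permutations of $S$ and $\Gamma_1,\Gamma_2\subset\Gamma_{C_0}$ proper subsets such that $(C\times C)(\Gamma_1)=\Gamma_2$. A complete (i.e. total) order on $S$ is compatible with $C_0$ if $C_0$ takes every non-maximal element to the next element in this order; then $\alpha_0=(s_{\max},s_{\min})\in\Gamma_{C_0}$, where $s_{\min},s_{\max}$ are the minimal and maximal elements. An associative BD-structure on a completely ordered set $S$ is an associative BD-structure on $S$ such that the order is compatible with $C_0$. Matrices. Let $(m^j_i)$, $i\in\mathbb{Z}/N\mathbb{Z}$, $j=0,\ldots,n-1$, be a matrix of integers, extended to all $j\in\mathbb{Z}$ by the rule $m^{j+n}_i=m^j_{i-1}$. The conditions are: (a) the differences $m^j_i-m^j_{i'}$ (for $i,i'\in\mathbb{Z}/N\mathbb{Z}$) take values only in $\{-1,0,1\}$; (b) for all $i\ne i'$ in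 $\mathbb{Z}/N\mathbb{Z}$ the periodic infinite sequence $(m^j_i-m^j_{i'})_{j\in\mathbb{Z}}$ is not identically $0$, and the occurrences of $1$ and $-1$ in it alternate. Construction. Given such a matrix, equip the set $\{1,\ldots,N\}=\mathbb{Z}/N\mathbb{Z}$ with the complete order $\prec$: $i\prec i'$ if either $m^0_i<m^0_{i'}$, or $m^0_i=m^0_{i'}$ and the first nonzero term in the sequence $(m^j_i-m^j_{i'})$, $j=0,1,\ldots$, is negative. Let $C_0$ be the transitive cyclic permutation compatible with $\prec$, let $C(i)=i-1$, let $$P_1=\{(i,i') : i\neq i',\ m^j_i=m^j_{i'}\text{ for }0<j<n,\text{ and }C(i)\prec C(i')\},$$ and put $\Gamma_1=P_1\cap\Gamma_{C_0}$, $\Gamma_2=(C\times C)(\Gamma_1)$. These data form an associative BD-structure on the completely ordered set $(\{1,\ldots,N\},\prec)$. *)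

(* Defs.v *)
From HB Require Import structures.
From mathcomp Require Import all_boot all_order all_algebra all_fingroup.

Set Implicit Arguments.
Unset Strict Implicit.
Unset Printing Implicit Defensive.

Import Order.TTheory GRing.Theory Num.Theory.
Local Open Scope ring_scope.

(** * Associative BD-structures *)

Definition transitive_cyclic (T : finType) (c : {perm T}) : Prop :=
  forall x : T, porbit c x = [set: T].

Definition Gamma (T : finType) (c : {perm T}) : {set T * T} :=
  [set (x, c x) | x : T].

Definition pair_map (T U : Type) (f : T -> U) (p : T * T) : U * U :=
  (f p.1, f p.2).

Record assoc_BD (T : finType) := AssocBD {
  bdC0 : {perm T};
  bdC : {perm T};
  bdG1 : {set T * T};
  bdG2 : {set T * T};
  bdC0_cyclic : transitive_cyclic bdC0;
  bdC_cyclic : transitive_cyclic bdC;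
  bdG1_proper : bdG1 \proper Gamma bdC0;
  bdG2_proper : bdG2 \proper Gamma bdC0;
  bdG12 : pair_map bdC @: bdG1 = bdG2
}.

(** Complete orders are given by their strict part [lt]; it is [Prop]-valued
    because the order attached to a matrix is defined by a condition on
    infinite sequences. *)
Definition compatible (T : finType) (lt : T -> T -> Prop) (c : {perm T}) :
  Prop :=
  forall x : T, (exists y, lt x y) ->
    lt x (c x) /\ (forall z, ~ (lt x z /\ lt z (c x))).

Definition order_lt (d : Order.disp_t) (S : finTBOrderType d) (x y : S) :
  Prop := (x < y)%O.

Definition alpha0 (d : Order.disp_t) (S : finTBOrderType d) : S * S :=
  (\top%O, \bot%O).

Definition BD_isomorphic
    (T : finType) (ltT : T -> T -> Prop) (D : assoc_BD T)
    (U : finType) (ltU : U -> U -> Prop) (E : assoc_BD U) : Prop :=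
  exists f : T -> U,
    [/\ bijective f,
        forall x y, ltT x y <-> ltU (f x) (f y),
        (forall x, f (bdC0 D x) = bdC0 E (f x)) /\
        (forall x, f (bdC D x) = bdC E (f x)),
        pair_map f @: bdG1 D = bdG1 E
      & pair_map f @: bdG2 D = bdG2 E].

Definition perm_zpow (T : finType) (c : {perm T}) (k : int) : {perm T} :=
  match k with
  | Posz n => (c ^+ n)%g
  | Negz n => (c ^- n.+1)%g
  end.

(** * The matrix construction *)

(** [Z/NZ] with [N = p.+1 >= 1] is the additive group ['I_p.+1]; ['Z_N] would
    be wrong for [N = 1].  The class of [1] is [Zp1] (which is [0] if [N = 1]).
    The matrix has [n.+1 >= 1] columns, and its entry [m i j] is $m^j_i$. *)

(** $m^j_i$ for all integers [j], where $m^{qn+r}_i = m^r_{i-q}$. *)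
Definition ext (p n : nat) (m : 'M[int]_(p.+1, n.+1)) (j : int)
    (i : 'I_p.+1) : int :=
  m (i - Zp1 *~ (j %/ n.+1%:Z)%Z) (inord `|(j %% n.+1%:Z)%Z|%N).

Lemma ext_small (p n : nat) (m : 'M[int]_(p.+1, n.+1)) (j : 'I_n.+1)
    (i : 'I_p.+1) : ext m j%:Z i = m i j.
Proof.
have jn : 0 <= j%:Z < `|n.+1%:Z|%N by rewrite /= ltz_nat ltn_ord.
by rewrite /ext divz_small // modz_small // mulr0z subr0 absz_nat inord_val.
Qed.

Lemma ext_shift (p n : nat) (m : 'M[int]_(p.+1, n.+1)) (j : int)
    (i : 'I_p.+1) : ext m (j + n.+1%:Z) i = ext m j (i - Zp1).
Proof.
by rewrite /ext modzDr divzDr ?dvdzz // divzz /= mulrzDr mulr1z opprD addrA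
  addrAC.
Qed.

Definition condition_a (p n : nat) (m : 'M[int]_(p.+1, n.+1)) : Prop :=
  forall (j : int) (i i' : 'I_p.+1),
    ext m j i - ext m j i' \in [:: -1; 0; 1].

(** Any two consecutive occurrences of elements of [{1, -1}] have opposite
    signs. *)
Definition alternating (u : int -> int) : Prop :=
  forall j l : int, j < l ->
    u j \in [:: 1; -1] -> u l \in [:: 1; -1] ->
    (forall t : int, j < t < l -> u t \notin [:: 1; -1]) ->
    u l = - u j.

Definition condition_b (p n : nat) (m : 'M[int]_(p.+1, n.+1)) : Prop :=
  forall i i' : 'I_p.+1, i != i' ->
    (exists j : int, ext m j i - ext m j i' != 0) /\
    alternating (fun j => ext m j i - ext m j i').

Definition first_nonzero_neg (u : nat -> int) : Prop :=
  exists j : nat, u j < 0 /\ (forall l : nat, (l < j)%N -> u l = 0).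

Definition prec (p n : nat) (m : 'M[int]_(p.+1, n.+1)) (i i' : 'I_p.+1) :
  Prop :=
  ext m 0 i < ext m 0 i' \/
  (ext m 0 i = ext m 0 i' /\
   first_nonzero_neg (fun j : nat => ext m j%:Z i - ext m j%:Z i')).

Definition matrix_P1 (p n : nat) (m : 'M[int]_(p.+1, n.+1))
    (i i' : 'I_p.+1) : Prop :=
  [/\ i != i',
      forall j : nat, (0 < j < n.+1)%N -> ext m j%:Z i = ext m j%:Z i'
    & prec m (i - Zp1) (i' - Zp1)].

(** [E] is the structure built from [m].  These conditions determine it, since
    $\Gamma_2$ is the image of $\Gamma_1$ by [bdG12]. *)
Definition matrix_BD (p n : nat) (m : 'M[int]_(p.+1, n.+1))
    (E : assoc_BD 'I_p.+1) : Prop :=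
  [/\ compatible (prec m) (bdC0 E),
      forall i, bdC E i = i - Zp1
    & forall i i', (i, i') \in bdG1 E <->
        matrix_P1 m i i' /\ (i, i') \in Gamma (bdC0 E)].

(* Main.v *)
Require Import Defs.
From HB Require Import structures.
From mathcomp Require Import all_boot all_order all_algebra all_fingroup.
From mathcomp Require Import cyclic zify.

Set Implicit Arguments.
Unset Strict Implicit.
Unset Printing Implicit Defensive.

Import Order.TTheory GRing.Theory Num.Theory.
Local Open Scope ring_scope.

(** Rank the elements of a completely ordered set by residues modulo [N], so
    that the order is the usual one and $C_0$ is the translation by [1].

    Given a matrix, order the rows at each column [j] by the first nonzero
    difference from [j] on ([prec_at]).  By condition (a) column [j] takes at
    most two values, which differ by [1], and by the alternation in (b) the
    order at [j + 1] is obtained from the order at [j] by moving the rows with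
    the smaller value above the others.  This is a rotation, so all these
    orders induce the same cyclic order ([cyclic_order_prec_at_succ]).  The
    order at the first column after the period is the initial order moved by
    $C$, so $C$ preserves the cyclic order and commutes with $C_0$
    ([matrix_BD_commute]); as both are $N$-cycles, $C$ is a power of $C_0$ with
    exponent prime to $N$.  A pair in $\Gamma_2$ is increasing by definition
    of $P_1$, so it is not $\alpha_0$.

    Conversely, an order with cyclic successor $C_0$ is determined by its
    minimum, so a matrix amounts to a sequence of cuts $b_j$ among the ranks,
    the entries of column [j] telling apart the cyclic intervals from $b_j$
    to $b_{j+1}$ and from $b_{j+1}$ to $b_j$.  If $C$ translates the ranks by
    [k], periodicity means that the cuts are translated by [- k] after one
    period ([cut_matrix]).  A pair $(s, C_0(s))$ lies in the set $P_1$ of such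
    a matrix exactly if the rank of $C_0(s)$ is not one of the cuts after the
    initial one, up to the first of the next period
    ([matrix_P1_cut_matrix]).  So it suffices to take as cuts the ranks of
    the second components of the pairs outside $\Gamma_1$ ([BD_matrix]); the
    cut starting the next period, which is forced to be the rank of
    $C^{-1}(s_{\min})$, is among these since $\alpha_0 \notin \Gamma_2$. *)

(** * Residues modulo [N] and cyclic permutations *)

Lemma val_ZpS (p : nat) (i : 'I_p.+1) : val (i + Zp1) = (i.+1 %% p.+1)%N.
Proof. by rewrite /= modnDmr addn1. Qed.

Lemma val_Zp_sub (p : nat) (u t : 'I_p.+1) :
  val (u - t) = (if t <= u then u - t else u + p.+1 - t)%N.
Proof.
rewrite /= modnDmr; have := ltn_ord u; have := ltn_ord t => lt_t lt_u.
case: leqP => [le_tu | lt_ut].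
  rewrite addnBA ?(ltnW lt_t) // addnC -addnBA // modnDl.
  by rewrite modn_small //; lia.
by rewrite modn_small; lia.
Qed.

Lemma Zp_ltS (p : nat) (u : 'I_p.+1) : (u < (u + Zp1)%R)%N = (u + Zp1 != 0).
Proof.
rewrite -val_eqE /=; have /= -> := val_ZpS u.
have [eq_up | ne_up] := eqVneq u.+1 p.+1.
  by rewrite eq_up modnn.
by rewrite modn_small ?ltnSn //; have := ltn_ord u; lia.
Qed.

(** Cutting ['I_p.+1] at [t] and moving the part below [t] to the top keeps
    the order inside each part and exchanges the two parts. *)
Lemma Zp_rotate (p : nat) (t u v : 'I_p.+1) :
  ((u - t)%R < (v - t)%R)%N =
  (if (t <= u) == (t <= v) then u < v else t <= u)%N.
Proof.
have := val_Zp_sub u t; have := val_Zp_sub v t => /= -> ->.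
have := ltn_ord u; have := ltn_ord v; have := ltn_ord t.
by case: (leqP t u); case: (leqP t v) => /=; lia.
Qed.

(** The orbit of a point parametrizes a transitive cyclic permutation by
    residues. *)
Lemma cyclic_param (T : finType) (p : nat) (c : {perm T}) (x0 : T) :
  #|T| = p.+1 -> transitive_cyclic c ->
  let g := fun i : 'I_p.+1 => iter i c x0 in
  [/\ bijective g, g 0 = x0 & forall i, g (i + Zp1) = c (g i)].
Proof.
move=> cardT cycc g.
have cardO : #|porbit c x0| = p.+1 by rewrite cycc cardsT.
have g_inj : injective g.
  move=> i j eq_g; apply: val_inj; apply/eqP => /=.
  have := uniq_traject_porbit c x0; rewrite cardO => /nth_uniq uniqE.
  rewrite -(uniqE x0) ?size_traject ?ltn_ord // !nth_traject ?ltn_ord //.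
  exact/eqP.
split=> //; first by apply: inj_card_bij; rewrite // cardT card_ord.
move=> i; rewrite /g -iterS val_ZpS.
have [-> | ne_ip] := eqVneq i.+1 p.+1.
  by rewrite modnn -cardO iter_porbit.
by rewrite modn_small //; have := ltn_ord i; lia.
Qed.

Lemma transitive_cyclicV (T : finType) (c : {perm T}) :
  transitive_cyclic c -> transitive_cyclic c^-1%g.
Proof. by move=> cycc x; rewrite porbitV. Qed.

(** A cyclic permutation compatible with a complete order is the translation
    by [1] of the ranks. *)
Lemma compatible_rank (d : Order.disp_t) (S : finTBOrderType d) (p : nat)
    (c : {perm S}) :
  #|S| = p.+1 -> transitive_cyclic c -> compatible (@order_lt d S) c ->
  exists pos : S -> 'I_p.+1,
    [/\ bijective pos, forall x y, (x < y)%O = (pos x < pos y)%N,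
        pos \bot%O = 0 & forall x, pos (c x) = pos x + Zp1].
Proof.
move=> cardS cycc compc.
pose rk (x : S) := #|[set y | (y < x)%O]|.
have rk_lt x y : (x < y)%O -> (rk x < rk y)%N.
  move=> lt_xy; apply: proper_card; apply/properP; split.
    by apply/subsetP=> z; rewrite !inE => /lt_trans; apply.
  by exists x; rewrite !inE ?ltxx.
have rk_bnd x : (rk x < p.+1)%N.
  rewrite -cardS -cardsT; apply: proper_card; apply/properP.
  by split; [apply/subsetP=> z; rewrite inE | exists x; rewrite ?inE ?ltxx].
have rk_top : rk \top%O = p.
  have -> : rk \top%O = #|[set~ (\top%O : S)]|.
    by apply: eq_card => y; rewrite !inE lt_neqAle lex1 andbT.
  by rewrite cardsC1 cardS.
have rkS x : x != \top%O -> rk (c x) = (rk x).+1.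
  move=> x_top; have [| lt_xc no_btw] := compc x.
    by exists \top%O; rewrite /order_lt ltx1.
  have -> : rk (c x) = #|x |: [set y | (y < x)%O]|.
    apply: eq_card => y; rewrite !inE.
    have [lt_yx | lt_xy | ->] := ltgtP y x; last exact: lt_xc.
      exact: lt_trans lt_yx lt_xc.
    by apply/negP=> lt_yc; case: (no_btw y).
  by rewrite cardsU1 inE ltxx.
have [[r gK rK] g0 gS] := cyclic_param \bot%O cardS cycc.
have rkg (i : nat) : (i < p.+1)%N -> rk (iter i c \bot%O) = i.
  elim: i => [_ | i IHi lt_i].
    by apply/eqP; rewrite cards_eq0 -subset0; apply/subsetP=> y;
      rewrite inE ltx0.
  rewrite iterS rkS ?IHi ?(ltnW lt_i) //.
  by apply/eqP=> itop; have := IHi (ltnW lt_i); rewrite itop rk_top; lia.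
have rkr x : rk x = r x by rewrite -{1}(rK x) rkg ?ltn_ord.
exists r; split; first by exists (fun i : 'I_p.+1 => iter i c \bot%O).
- move=> x y; rewrite -!rkr; have [/rk_lt -> // | /rk_lt | ->] := ltgtP x y.
    by move=> lt_yx; apply/esym/negbTE; rewrite -leqNgt ltnW.
  by rewrite ltnn.
- by rewrite -{1}g0 gK.
by move=> x; rewrite -{1}(rK x) -gS gK.
Qed.

(** * The orders attached to the columns of a matrix *)

(** The order of the rows read from column [j] on: [i] precedes [i'] if the
    first nonzero term of $m^l_i - m^l_{i'}$, $l \ge j$, is negative. *)
Definition prec_at (p n : nat) (m : 'M[int]_(p.+1, n.+1)) (j : nat)
    (i i' : 'I_p.+1) : Prop :=
  first_nonzero_neg (fun l => ext m (j + l)%N%:Z i - ext m (j + l)%N%:Z i').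

Lemma precE (p n : nat) (m : 'M[int]_(p.+1, n.+1)) (i i' : 'I_p.+1) :
  prec m i i' <-> prec_at m 0 i i'.
Proof.
split=> [[lt_ii' | [_ //]] | first_neg].
  by exists 0%N; split=> //; rewrite subr_lt0.
have [[| l] [neg_l zero_l]] := first_neg; first by left; rewrite -subr_lt0.
by right; split=> //; apply/eqP; rewrite -subr_eq0 (zero_l 0%N).
Qed.

Lemma prec_at_period (p n : nat) (m : 'M[int]_(p.+1, n.+1)) (i i' : 'I_p.+1) :
  prec_at m n.+1 i i' <-> prec_at m 0 (i - Zp1) (i' - Zp1).
Proof.
have shift l i0 : ext m (n.+1 + l)%N%:Z i0 = ext m l%:Z (i0 - Zp1).
  by rewrite addnC PoszD ext_shift.
by split=> -[l [neg_l zero_l]]; exists l; split=> [| k /zero_l];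
  rewrite ?add0n ?shift // -!shift.
Qed.

Lemma prec_at_lt (p n : nat) (m : 'M[int]_(p.+1, n.+1)) (j : nat)
    (i i' : 'I_p.+1) : ext m j i < ext m j i' -> prec_at m j i i'.
Proof. by exists 0%N; split=> //; rewrite addn0 subr_lt0. Qed.

(** By alternation, two rows with unequal entries in column [j] are in opposite
    orders at [j] and [j.+1]; equal entries do not change the order. *)
Lemma prec_at_succ (p n : nat) (m : 'M[int]_(p.+1, n.+1)) (j : nat)
    (i i' : 'I_p.+1) :
  condition_a m -> condition_b m -> prec_at m j.+1 i i' ->
  (ext m j i = ext m j i' /\ prec_at m j i i') \/
  (ext m j i' < ext m j i /\ prec_at m j i' i).
Proof.
move=> ma mb [l [neg_l zero_l]].
have [lt_ii' | lt_i'i | eq_ii'] := ltgtP (ext m j i) (ext m j i'); last first.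
- left; split=> //; exists l.+1; split=> [| [| k] lt_kl];
    rewrite -?addSnnS ?addn0 ?eq_ii' ?subrr //.
  exact: zero_l.
- by right; split=> //; exact: prec_at_lt.
have ne_ii' : i != i' by apply: contraTneq lt_ii' => ->; rewrite ltxx.
have [_ alt] := mb i i' ne_ii'.
have eqN1 t : ext m t i - ext m t i' < 0 -> ext m t i - ext m t i' = -1.
  by have := ma t i i'; rewrite !inE; lia.
have jN1 := eqN1 j%:Z; have lN1 := eqN1 (j.+1 + l)%N%:Z.
have := alt j%:Z (j.+1 + l)%N%:Z; rewrite jN1 ?subr_lt0 // lN1 // !inE.
have zero_btw t : j%:Z < t < (j.+1 + l)%N%:Z ->
    ext m t i - ext m t i' \notin [:: 1; -1].
  move=> /andP[lt_jt lt_tl].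
  have -> : t = (j.+1 + `|t - j.+1%:Z|)%N%:Z by lia.
  by rewrite zero_l //; lia.
by move=> /(_ _ isT isT zero_btw); rewrite ltz_nat => /(_ ltac:(lia)).
Qed.

(** The cyclic order induced by an order relation. *)
Definition cyclic_order (T : Type) (lt : T -> T -> Prop) (x y z : T) : Prop :=
  lt x y /\ lt y z \/ lt y z /\ lt z x \/ lt z x /\ lt x y.

(** The order at [j.+1] is obtained from the order at [j] by moving the lower
    set of the smaller entries of column [j] above the others, and a rotation
    does not change the cyclic order. *)
Lemma cyclic_order_prec_at_succ (p n : nat) (m : 'M[int]_(p.+1, n.+1))
    (j : nat) (x y z : 'I_p.+1) :
  condition_a m -> condition_b m ->
  cyclic_order (prec_at m j.+1) x y z -> cyclic_order (prec_at m j) x y z.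
Proof.
move=> ma mb.
suffices chain a b c : prec_at m j.+1 a b -> prec_at m j.+1 b c ->
    cyclic_order (prec_at m j) a b c.
  by case=> [|[]] -[/chain E /E {E}]; rewrite /cyclic_order; tauto.
move=> /(prec_at_succ ma mb) ab /(prec_at_succ ma mb) bc.
have := ma j%:Z a c; rewrite !inE /cyclic_order.
case: ab => -[ab jab]; case: bc => -[bc jbc] ac; last by lia.
- by tauto.
- have jca : prec_at m j c a by apply: prec_at_lt; rewrite ab.
  by tauto.
have jca : prec_at m j c a by apply: prec_at_lt; rewrite -bc.
by tauto.
Qed.

(** Over one period the orders at the columns go from the initial order to its
    image under $C$. *)
Lemma cyclic_order_shift (p n : nat) (m : 'M[int]_(p.+1, n.+1))
    (x y z : 'I_p.+1) :
  condition_a m -> condition_b m ->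
  cyclic_order (prec m) (x - Zp1) (y - Zp1) (z - Zp1) ->
  cyclic_order (prec m) x y z.
Proof.
move=> ma mb; rewrite /cyclic_order !precE -!prec_at_period.
rewrite -/(cyclic_order (prec_at m n.+1) x y z).
rewrite -/(cyclic_order (prec_at m 0) x y z).
by elim: n.+1 => // j IHj /(cyclic_order_prec_at_succ ma mb).
Qed.

(** * Structures given by matrices *)

Lemma Zp_cyclic_order_succ (p : nat) (a b : 'I_p.+1) :
  b != a -> b != a + Zp1 ->
  cyclic_order (fun u v : 'I_p.+1 => u < v : Prop)%N a (a + Zp1) b.
Proof.
rewrite -!val_eqE /cyclic_order; have /= -> := val_ZpS a.
have lt_a := ltn_ord a; have lt_b := ltn_ord b.
have [eq_ap | ne_ap] := eqVneq a.+1 p.+1; first by rewrite eq_ap modnn; lia.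
by rewrite modn_small; lia.
Qed.

Lemma Zp_cyclic_order_notin (p : nat) (a b : 'I_p.+1) :
  ~ cyclic_order (fun u v : 'I_p.+1 => u < v : Prop)%N a b (a + Zp1).
Proof.
rewrite /cyclic_order; have /= -> := val_ZpS a.
have lt_a := ltn_ord a; have lt_b := ltn_ord b.
have [eq_ap | ne_ap] := eqVneq a.+1 p.+1; first by rewrite eq_ap modnn; lia.
by rewrite modn_small; lia.
Qed.

(** A bijection reflecting the cyclic order commutes with the cyclic
    successor. *)
Lemma cyclic_order_commutes (p : nat) (c : 'I_p.+1 -> 'I_p.+1) :
  bijective c ->
  (forall x y z,
    cyclic_order (fun u v : 'I_p.+1 => u < v : Prop)%N (c x) (c y) (c z) ->
    cyclic_order (fun u v : 'I_p.+1 => u < v : Prop)%N x y z) ->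
  forall x, c (x + Zp1) = c x + Zp1.
Proof.
move=> [c' cK c'K] c_cyc x; apply/eqP/idP; apply: contraT => ne_cx.
have [fixx | ne_x] := eqVneq (c (x + Zp1)) (c x).
  (* then [Zp1 = 0], that is, [p = 0], and there is nothing to prove *)
  have := congr1 c' fixx; rewrite !cK => Zp10.
  rewrite fixx -{1}(addr0 (c x)) (inj_eq (addrI _)) in ne_cx.
  by rewrite -(inj_eq (addrI x)) addr0 Zp10 eqxx in ne_cx.
have := Zp_cyclic_order_succ ne_x ne_cx; rewrite -(c'K (c x + Zp1)).
by move=> /c_cyc /Zp_cyclic_order_notin.
Qed.

Lemma transitive_cyclic_order (T : finType) (c : {perm T}) (x0 : T) :
  transitive_cyclic c -> #[c]%g = #|T|.
Proof.
move=> cycc; have cardO x : #|porbit c x| = #|T| by rewrite cycc cardsT.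
apply/eqP; rewrite eqn_leq; apply/andP; split.
  rewrite dvdn_leq //; first by apply/card_gt0P; exists x0.
  rewrite order_dvdn; apply/eqP/permP=> x.
  by rewrite permX perm1 -(cardO x) iter_porbit.
by rewrite -(cardO x0) [@porbit]unlock orderE leq_imset_card.
Qed.

(** A permutation commuting with a full cycle is determined by one value. *)
Lemma commute_transitive_cyclic (T : finType) (c c0 : {perm T}) (x0 : T) :
  transitive_cyclic c0 -> commute c c0 -> exists k : nat, c = (c0 ^+ k)%g.
Proof.
move=> cyc0 com_c; have /porbitP[k ck] : c x0 \in porbit c0 x0.
  by rewrite cyc0 inE.
exists k; apply/permP=> x; have /porbitP[a ->] : x \in porbit c0 x0.
  by rewrite cyc0 inE.
by rewrite -permM -(commuteX a com_c) permM ck -!permM -!expgnDr addnC.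
Qed.

Lemma commute_transitive_cyclic_coprime (T : finType) (c c0 : {perm T})
    (x0 : T) :
  transitive_cyclic c0 -> transitive_cyclic c -> commute c c0 ->
  exists k : nat, coprime k #|T| /\ c = (c0 ^+ k)%g.
Proof.
move=> cyc0 cycc com_c.
have [k def_c] := commute_transitive_cyclic x0 cyc0 com_c.
have [b def_c0] := commute_transitive_cyclic x0 cycc (commute_sym com_c).
exists k; split=> //; have : (c0 ^+ (k * b) == c0 ^+ 1)%g.
  by rewrite expgnA -def_c -def_c0 expg1.
rewrite eq_expg_mod_order (transitive_cyclic_order x0 cyc0) => /eqP kb1.
have : coprime (k * b) #|T| by rewrite -coprime_modl kb1 coprime_modl coprime1n.
by rewrite coprimeMl => /andP[].
Qed.

Lemma matrix_BD_commute (d : Order.disp_t) (S : finTBOrderType d) (p n : nat)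
    (D : assoc_BD S) (m : 'M[int]_(p.+1, n.+1)) (E : assoc_BD 'I_p.+1) :
  #|S| = p.+1 -> compatible (@order_lt d S) (bdC0 D) ->
  condition_a m -> condition_b m -> matrix_BD m E ->
  BD_isomorphic (@order_lt d S) D (prec m) E ->
  commute (bdC D) (bdC0 D).
Proof.
move=> cardS compD ma mb [_ CE _] [f [_ f_lt [_ fC] _ _]].
have [pos [[r posK rK] pos_lt _ posS]] :=
  compatible_rank cardS (@bdC0_cyclic _ D) compD.
pose c u := pos (bdC D (r u)).
have bij_c : bijective c.
  by exists (fun u => pos ((bdC D)^-1%g (r u))) => u;
    rewrite /c posK ?permK ?permKV rK.
have cycE (s : S -> S) (s' : 'I_p.+1 -> 'I_p.+1) u v w :
    (forall x, f (s x) = s' (f x)) ->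
    cyclic_order (fun u v : 'I_p.+1 => u < v : Prop)%N
      (pos (s (r u))) (pos (s (r v))) (pos (s (r w))) <->
    cyclic_order (prec m) (s' (f (r u))) (s' (f (r v))) (s' (f (r w))).
  by move=> fs; rewrite /cyclic_order -!pos_lt -!fs -!f_lt.
have c_cyc x y z :
    cyclic_order (fun u v : 'I_p.+1 => u < v : Prop)%N (c x) (c y) (c z) ->
    cyclic_order (fun u v : 'I_p.+1 => u < v : Prop)%N x y z.
  have [_] := cycE id id x y z (fun=> erefl); rewrite !rK => to_xyz.
  rewrite (cycE (bdC D) (bdC E)) // !CE => /cyclic_order_shift.
  by move=> /(_ ma mb).
have cS := cyclic_order_commutes bij_c c_cyc.
apply/permP=> x; apply: (can_inj posK); rewrite !permM posS.
by have := cS (pos x); rewrite /c -posS !posK.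
Qed.

Lemma matrix_BD_alpha0 (d : Order.disp_t) (S : finTBOrderType d) (p n : nat)
    (D : assoc_BD S) (m : 'M[int]_(p.+1, n.+1)) (E : assoc_BD 'I_p.+1) :
  matrix_BD m E -> BD_isomorphic (@order_lt d S) D (prec m) E ->
  alpha0 S \notin bdG2 D.
Proof.
move=> [_ CE P1E] [f [_ f_lt _ _ fG2]]; apply/negP=> in_G2.
have : pair_map f (alpha0 S) \in bdG2 E by rewrite -fG2 imset_f.
rewrite -bdG12 => /imsetP[[i i'] /P1E[[_ _]]]; rewrite -!CE => lt_ii' _.
case=> top_i bot_i'; move: lt_ii'; rewrite -top_i -bot_i' -f_lt.
by rewrite /order_lt ltx0.
Qed.

(** * The matrix of a sequence of cuts *)

Section CutMatrix.

(** [q i] is the rank of the row [i], and $C_0$ is the translation by [1] of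
    the ranks.  The smallest rank of the order at column [j] is the cut [b j].
    The row [i] has in column [j + n.+1] the entry that the row $C(i)$ has in
    column [j], and $C$ translates the ranks by [k], hence [b_shift]. *)
Variables (p n : nat) (k : 'I_p.+1) (q : 'I_p.+1 -> 'I_p.+1)
  (b : int -> 'I_p.+1).
Hypothesis q_inj : injective q.
Hypothesis q0 : q 0 = 0.
Hypothesis q_shift : forall i, q (i - Zp1) = q i + k.
Hypothesis b0 : b 0 = 0.
Hypothesis b_shift : forall j, b (j + n.+1%:Z) = b j - k.

(** The rank of the row [i] lies in the cyclic interval from [b (j + 1)]
    included to [b j] excluded.  If these two cuts are equal, the interval
    consists of all the ranks. *)
Definition cut_bit (j : int) (i : 'I_p.+1) : bool :=
  ((b (j + 1) - b j)%R <= (q i - b j)%R)%N.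

(** The order of the rows that is obtained by starting at the cut [b j]. *)
Definition cut_lt (j : int) (i i' : 'I_p.+1) : bool :=
  ((q i - b j)%R < (q i' - b j)%R)%N.

(** Column [j] is the indicator function of [cut_bit j], so it separates the
    intervals between the cuts [b j] and [b (j + 1)]. *)
Definition cut_matrix : 'M[int]_(p.+1, n.+1) :=
  \matrix_(i, j) (cut_bit j%:Z i)%:Z.

Lemma q_shiftz (a : int) i : q (i - Zp1 *~ a) = q i + k *~ a.
Proof.
elim/int_rect: a => [| a IHa | a IHa]; first by rewrite !mulr0z subr0 addr0.
  by rewrite (intS a) [1 + _]addrC !mulrzDr !mulr1z opprD !addrA q_shift IHa.
rewrite (intS a) [1 + _]addrC opprD !mulrzDr !mulrN1z opprD opprK.
apply: (addIr k); rewrite -q_shift [in RHS]addrA subrK -IHa.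
by rewrite addrA addrK.
Qed.

Lemma b_shiftz (a j : int) : b (j + a * n.+1%:Z) = b j - k *~ a.
Proof.
elim/int_rect: a => [| a IHa | a IHa].
- by rewrite mul0r mulr0z addr0 subr0.
- rewrite (intS a) [1 + _]addrC mulrDl mul1r mulrzDr mulr1z addrA b_shift IHa.
  by rewrite opprD addrA.
rewrite (intS a) [1 + _]addrC opprD mulrDl mulN1r mulrzDr mulrN1z.
apply: (addIr (- k)); rewrite -b_shift addrA subrK IHa opprD opprK.
by rewrite addrA addrK.
Qed.

Lemma ext_cut_matrix (j : int) i : ext cut_matrix j i = (cut_bit j i)%:Z.
Proof.
have n1_gt0 : 0 < n.+1%:Z :> int by [].
have mod_ge0 : 0 <= (j %% n.+1%:Z)%Z by rewrite modz_ge0.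
have lt_mod : (`|(j %% n.+1%:Z)%Z| < n.+1)%N.
  by rewrite -ltz_nat gez0_abs // ltz_pmod.
rewrite /ext mxE inordK // gez0_abs // /cut_bit q_shiftz.
set a := (j %/ _)%Z; set r := (j %% _)%Z.
have -> : j = r + a * n.+1%:Z by rewrite addrC -divz_eq.
rewrite [r + _ + 1]addrAC !b_shiftz opprB [k *~ a + _]addrC.
by rewrite [- b r + _]addrC !addrA subrK.
Qed.

Lemma cut_lt_succ (j : int) i i' :
  cut_lt (j + 1) i i' =
  if cut_bit j i == cut_bit j i' then cut_lt j i i' else cut_bit j i.
Proof.
rewrite /cut_bit /cut_lt -Zp_rotate.
by rewrite !opprB !addrA !subrK.
Qed.

Lemma cut_bit_lt (j : int) i i' :
  ~~ cut_bit j i -> cut_bit j i' -> cut_lt j i i'.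
Proof. by rewrite /cut_bit /cut_lt -ltnNge; apply: leq_trans. Qed.

Lemma cut_lt_total (j : int) i i' :
  i != i' -> cut_lt j i' i = ~~ cut_lt j i i'.
Proof.
move=> ne_ii'; rewrite /cut_lt -leqNgt ltn_neqAle (inj_eq (@ord_inj _)).
by rewrite (inj_eq (addIr _)) (inj_eq q_inj) eq_sym ne_ii'.
Qed.

Lemma cut_lt_const (j l : int) i i' :
  j <= l -> (forall t, j <= t < l -> cut_bit t i = cut_bit t i') ->
  cut_lt l i i' = cut_lt j i i'.
Proof.
move=> le_jl; have -> : l = j + `|l - j|%N by lia.
elim: `|l - j|%N => [| e IHe] eq_bit; first by rewrite addr0.
rewrite -addn1 PoszD addrA cut_lt_succ eq_bit ?eqxx; last by lia.
by apply: IHe => t ?; apply: eq_bit; lia.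
Qed.

(** Every rank is a cut, and of two rows the one whose rank is the cut comes
    first. *)
Lemma cut_bit_separates i i' :
  i != i' -> exists j : nat, cut_bit j i != cut_bit j i'.
Proof.
move=> ne_ii'.
have [/existsP[j ne_j] | no_j] :=
  boolP [exists j : 'I_(p.+1 * n.+1), cut_bit j i != cut_bit j i'].
  by exists j.
have cst (a : 'I_p.+1) : cut_lt (a%:Z * n.+1%:Z) i i' = cut_lt 0 i i'.
  apply: cut_lt_const => // t /andP[t_ge0 lt_t].
  have lt_tp : (`|t| < p.+1 * n.+1)%N by have := ltn_ord a; nia.
  have := no_j; rewrite negb_exists => /forallP/(_ (Ordinal lt_tp)) /=.
  by rewrite negbK gez0_abs // => /eqP.
have b_q (a : 'I_p.+1) : b (a%:Z * n.+1%:Z) = q a.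
  rewrite -[X in b X]add0r b_shiftz b0 sub0r -mulrNz.
  have Zp1a : Zp1 *~ a%:Z = a.
    rewrite -pmulrn Zp_mulrn; apply: val_inj.
    by rewrite /= modnMml mul1n modn_small.
  have /esym := q_shiftz (- a%:Z) 0; rewrite q0 add0r sub0r => ->.
  by rewrite mulrNz opprK Zp1a.
have := cst i'; rewrite -(cst i) /cut_lt !b_q !subrr ltn0 => /esym/negbT.
rewrite -leqNgt leqn0 => /eqP qd0.
have /eqP : q i' - q i = 0 by apply: val_inj.
by rewrite subr_eq0 (inj_eq q_inj) eq_sym (negbTE ne_ii').
Qed.

Lemma cut_matrix_a : condition_a cut_matrix.
Proof.
by move=> j i i'; rewrite !ext_cut_matrix; case: cut_bit; case: cut_bit.
Qed.

Lemma cut_matrix_b : condition_b cut_matrix.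
Proof.
move=> i i' ne_ii'; split.
  have [j ne_j] := cut_bit_separates ne_ii'; exists j%:Z.
  by rewrite !ext_cut_matrix; case: cut_bit ne_j; case: cut_bit.
move=> j l lt_jl; rewrite !ext_cut_matrix => sep_j sep_l eq_btw.
have cst : cut_lt l i i' = cut_lt (j + 1) i i'.
  apply: cut_lt_const => [| t lt_t]; first by lia.
  have := eq_btw t; rewrite !ext_cut_matrix.
  by case: cut_bit; case: cut_bit => // /(_ ltac:(lia)).
have := cut_bit_lt (j := l) (i := i) (i' := i').
have := cut_bit_lt (j := l) (i := i') (i' := i).
rewrite (cut_lt_total _ ne_ii') cst cut_lt_succ; move: sep_j sep_l.
by case: (cut_bit j i); case: (cut_bit j i'); case: (cut_bit l i);
  case: (cut_bit l i') => //= _ _ h1 h2;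
  by [have := h1 isT isT | have := h2 isT isT].
Qed.

Lemma prec_cut_matrix i i' : prec cut_matrix i i' <-> (q i < q i')%N.
Proof.
have -> : (q i < q i')%N = cut_lt 0 i i' by rewrite /cut_lt b0 !subr0.
rewrite precE; split=> [[l [neg_l zero_l]] | lt_ii'].
  rewrite -(@cut_lt_const 0 l) // => [| t lt_t].
    apply: cut_bit_lt; move: neg_l; rewrite !ext_cut_matrix;
    by do 2 case: cut_bit.
  have := zero_l `|t|%N; rewrite add0n gez0_abs ?ext_cut_matrix; last by lia.
  by case: cut_bit; case: cut_bit => // /(_ ltac:(lia)).
have ne_ii' : i != i' by apply: contraTneq lt_ii' => ->; rewrite /cut_lt ltnn.
have sep := cut_bit_separates ne_ii'; exists (ex_minn sep).
case: ex_minnP => l ne_l min_l.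
have eq_bit (t : nat) : (t < l)%N -> cut_bit t i = cut_bit t i'.
  by apply: contraTeq => /min_l; rewrite -leqNgt.
split=> [| t lt_tl]; rewrite !ext_cut_matrix add0n.
  have := cut_bit_lt (j := l) (i := i') (i' := i).
  rewrite (cut_lt_total _ ne_ii') (@cut_lt_const 0 l) ?lt_ii' //; last first.
    by move=> t /andP[t0 lt_t]; rewrite -(gez0_abs t0) eq_bit //; lia.
  by case: cut_bit ne_l; case: cut_bit => // _ /(_ isT isT).
by rewrite eq_bit // subrr.
Qed.

(** A row and its cyclic successor are in this order at [j] exactly if the
    rank of the latter is not the cut at [j]; in this way the cuts from [1]
    to [n.+1] determine the set $P_1 \cap \Gamma_{C_0}$. *)
Lemma matrix_P1_cut_matrix i i' : q i' = q i + Zp1 ->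
  matrix_P1 cut_matrix i i' <->
  (forall j : nat, (0 < j <= n.+1)%N -> q i' != b j).
Proof.
move=> qS.
have cut_ltS j : cut_lt j i i' = (q i' != b j).
  by rewrite /cut_lt qS [q i + _ - _]addrAC Zp_ltS addrAC subr_eq0.
have prec_last : prec cut_matrix (i - Zp1) (i' - Zp1) <-> cut_lt n.+1 i i'.
  rewrite prec_cut_matrix /cut_lt !q_shift -[n.+1%:Z]add0r b_shift b0.
  by rewrite sub0r opprK.
split=> [[_ eq_ext /prec_last lt_last] j /andP[j_gt0 le_jn] | no_cut].
  rewrite -cut_ltS -(@cut_lt_const j n.+1) // => t /andP[le_jt lt_tn].
  have := eq_ext `|t|%N; rewrite !ext_cut_matrix gez0_abs; last by lia.
  by do 2 case: cut_bit; move=> // /(_ ltac:(lia)).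
have lt_j (j : nat) : (0 < j <= n.+1)%N -> cut_lt j i i'.
  by rewrite cut_ltS; apply: no_cut.
have ne_ii' : i != i'.
  by apply: contraTneq (lt_j n.+1 (leqnn _)) => ->; rewrite /cut_lt ltnn.
split=> // [j /andP[j_gt0 lt_jn] |]; last by apply/prec_last/lt_j/leqnn.
have := lt_j j.+1 lt_jn; rewrite -addn1 PoszD cut_lt_succ !ext_cut_matrix.
have := cut_bit_lt (j := j) (i := i') (i' := i).
rewrite (cut_lt_total _ ne_ii') lt_j ?j_gt0 ?(ltnW lt_jn) //.
by case: (cut_bit j i); case: (cut_bit j i') => //= /(_ isT isT).
Qed.

End CutMatrix.

(** * The matrix of a given structure *)

Lemma pair_map_inj (T U : Type) (f : T -> U) :
  injective f -> injective (pair_map f).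
Proof. by move=> f_inj [x y] [x' y'] [/f_inj -> /f_inj ->]. Qed.

(** Transport of a structure along a bijection. *)
Lemma BD_transport (T U : finType) (D : assoc_BD T) (f : T -> U) (g : U -> T) :
  cancel f g -> cancel g f ->
  exists E : assoc_BD U,
    [/\ forall u, bdC0 E u = f (bdC0 D (g u)),
        forall u, bdC E u = f (bdC D (g u)),
        pair_map f @: bdG1 D = bdG1 E & pair_map f @: bdG2 D = bdG2 E].
Proof.
move=> fK gK; have [f_inj g_inj] := (can_inj fK, can_inj gK).
have conj_inj (c : {perm T}) : injective (fun u => f (c (g u))).
  by move=> u v /f_inj /perm_inj /g_inj.
pose cnj c : {perm U} := perm (conj_inj c).
have cnjE c u : cnj c u = f (c (g u)) by rewrite permE.
have cyc_cnj c : transitive_cyclic c -> transitive_cyclic (cnj c).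
  move=> cycc u; apply/setP=> v; rewrite inE; apply/porbitP.
  have /porbitP[a def_v] : g v \in porbit c (g u) by rewrite cycc inE.
  exists a; apply: g_inj; rewrite def_v !permX.
  by elim: a {def_v} => //= a IHa; rewrite cnjE fK IHa.
have Gamma_cnj c : pair_map f @: Gamma c = Gamma (cnj c).
  apply/setP=> -[u v]; apply/imsetP/imsetP=> [[_ /imsetP[x _ ->] [-> ->]] |].
    by exists (f x); rewrite // cnjE fK.
  case=> w _ [-> ->]; exists (g w, c (g w)); first exact: imset_f.
  by rewrite /pair_map /= gK cnjE.
have prop_cnj c (G : {set T * T}) :
    G \proper Gamma c -> pair_map f @: G \proper Gamma (cnj c).
  move=> /properP[sGc [z zc zG]]; rewrite -Gamma_cnj; apply/properP.
  split; first exact: imsetS.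
  by exists (pair_map f z); rewrite (mem_imset _ _ (pair_map_inj f_inj)).
have G12 : pair_map (cnj (bdC D)) @: (pair_map f @: bdG1 D) =
    pair_map f @: bdG2 D.
  rewrite -bdG12 -!imset_comp; apply: eq_imset => -[x y].
  by rewrite /pair_map /= !cnjE !fK.
exists (AssocBD (cyc_cnj _ (@bdC0_cyclic _ D)) (cyc_cnj _ (@bdC_cyclic _ D))
  (prop_cnj _ _ (bdG1_proper D)) (prop_cnj _ _ (bdG2_proper D)) G12).
by split=> //= u; rewrite cnjE.
Qed.

Lemma perm_zpow_rank (T : finType) (p : nat) (pos : T -> 'I_p.+1)
    (c : {perm T}) (k : int) x :
  (forall y, pos (c y) = pos y + Zp1) ->
  pos (perm_zpow c k x) = pos x + Zp1 *~ k.
Proof.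
move=> posS; have posX a y : pos ((c ^+ a)%g y) = pos y + Zp1 *+ a.
  rewrite permX; elim: a => [| a IHa]; first by rewrite mulr0n addr0.
  by rewrite iterS posS IHa mulrSr addrA.
case: k => a /=; first by rewrite posX pmulrn.
by apply: (addIr (Zp1 *+ a.+1)); rewrite -posX permKV NegzE mulrNz subrK.
Qed.

(** The structures satisfying the two conditions come from matrices. *)
Lemma BD_matrix (d : Order.disp_t) (S : finTBOrderType d) (p : nat)
    (D : assoc_BD S) (k : int) :
  #|S| = p.+1 -> compatible (@order_lt d S) (bdC0 D) ->
  alpha0 S \notin bdG2 D -> bdC D = perm_zpow (bdC0 D) k ->
  exists (n : nat) (m : 'M[int]_(p.+1, n.+1)) (E : assoc_BD 'I_p.+1),
    [/\ condition_a m, condition_b m, matrix_BD m E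
      & BD_isomorphic (@order_lt d S) D (prec m) E].
Proof.
move=> cardS compD no_alpha0 CE.
have [pos [[r posK rK] pos_lt pos0 posS]] :=
  compatible_rank cardS (@bdC0_cyclic _ D) compD.
set c0 := bdC0 D in compD CE posS *; set c := bdC D in CE *.
have posC x : pos (c x) = pos x + Zp1 *~ k.
  by rewrite CE; apply: perm_zpow_rank.
(* the rows are indexed by iterating the inverse of [c], as [c] has to
   become the translation by [-1] *)
pose g (i : 'I_p.+1) := iter i c^-1%g \bot%O.
have [[f gK fK] g0 gS] :
    [/\ bijective g, g 0 = \bot%O & forall i, g (i + Zp1) = c^-1%g (g i)].
  exact: cyclic_param cardS (transitive_cyclicV (@bdC_cyclic _ D)).
have gP i : g (i - Zp1) = c (g i).
  by rewrite -{2}(subrK Zp1 i) gS permKV.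
pose q i := pos (g i).
have q_inj : injective q by apply: inj_comp (can_inj posK) (can_inj gK).
have q0 : q 0 = 0 by rewrite /q g0.
have q_shift i : q (i - Zp1) = q i + Zp1 *~ k by rewrite /q gP posC.
(* the cuts in columns [1] to [n.+1] are the second components of the pairs
   outside [bdG1 D]; the last one is fixed by [b_shift], and it is allowed
   since [alpha0 S] is not in [bdG2 D] *)
pose Z := [set y | (c0^-1%g y, y) \notin bdG1 D].
pose n := #|Z|; pose s := 0 :: map pos (enum Z).
pose b (j : int) := s`_`|(j %% n.+1%:Z)%Z| - Zp1 *~ k *~ (j %/ n.+1%:Z)%Z.
have b0 : b 0 = 0 by rewrite /b mod0z div0z mulr0z subr0.
have b_shift j : b (j + n.+1%:Z) = b j - Zp1 *~ k.
  by rewrite /b modzDr divzDr ?dvdzz // divzz /= mulrzDr mulr1z opprD addrA.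
have b_small (j : nat) : (j < n.+1)%N -> b j = s`_j.
  move=> lt_jn; have jn : 0 <= j%:Z < `|n.+1%:Z|%N by rewrite /= ltz_nat.
  by rewrite /b divz_small // modz_small // mulr0z subr0.
have botZ : c^-1%g \bot%O \in Z.
  rewrite inE; apply: contra no_alpha0 => inG1.
  have := imset_f (pair_map c) inG1; rewrite bdG12 /pair_map /= permKV => inG2.
  have := inG2; have /properP[/subsetP sG2 _] := bdG2_proper D.
  have /imsetP[x _ [-> c0x]] := sG2 _ inG2.
  have [-> // | x_top] := eqVneq x \top%O.
  have [| lt_x _] := compD x; first by exists \top%O; rewrite /order_lt ltx1.
  by move: lt_x; rewrite /order_lt -/c0 -c0x ltx0.
have b_last : b n.+1 = pos (c^-1%g \bot%O).
  rewrite -[n.+1%:Z]add0r b_shift b0 sub0r; apply: (addIr (Zp1 *~ k)).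
  by rewrite -posC permKV pos0 addNr.
have cutsP y : y \in Z <-> exists2 j : nat, (0 < j <= n.+1)%N & pos y = b j.
  split=> [yZ | [j /andP[j_gt0]]].
    have lt_y : (index y (enum Z) < n)%N by rewrite /n cardE index_mem mem_enum.
    exists (index y (enum Z)).+1; first by rewrite /= ltnS ltnW.
    rewrite b_small //= (nth_map \bot%O) -?cardE //.
    by rewrite nth_index ?mem_enum.
  rewrite leq_eqVlt => /predU1P[-> | lt_jn].
    by rewrite b_last => /(can_inj posK) ->.
  rewrite b_small //; case: j j_gt0 lt_jn => //= j _ lt_jn.
  rewrite (nth_map \bot%O) -?cardE // => /(can_inj posK) ->.
  by rewrite -mem_enum mem_nth // -cardE.
pose m := cut_matrix n q b.
have [E [C0E CEE G1E G2E]] := BD_transport D fK gK.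
have prec_m i i' : prec m i i' <-> order_lt (g i) (g i').
  by rewrite (prec_cut_matrix q_inj q0 q_shift b0 b_shift) /order_lt pos_lt.
have f_prec x y : order_lt x y <-> prec m (f x) (f y).
  by rewrite prec_m !fK.
exists n, m, E; split.
- exact: cut_matrix_a q_shift b_shift.
- exact: cut_matrix_b q_inj q0 q_shift b0 b_shift.
- split=> [i [i' /prec_m lt_i] | i | i i'].
  + have [| lt_gi no_btw] := compD (g i); first by exists (g i').
    rewrite C0E prec_m fK; split=> // j; rewrite !prec_m fK; exact: no_btw.
  + by rewrite CEE -gP gK.
  have inG1 : (i, i') \in bdG1 E = ((g i, g i') \in bdG1 D).
    have -> : (i, i') = pair_map f (g i, g i') by rewrite /pair_map /= !gK.
    by rewrite -G1E (mem_imset _ _ (pair_map_inj (can_inj fK))).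
  have inGamma : (i, i') \in Gamma (bdC0 E) <-> g i' = c0 (g i).
    split=> [/imsetP[x _ [-> ->]] | gi']; first by rewrite C0E fK.
    by apply/imsetP; exists i; rewrite // C0E -/c0 -gi' gK.
  have G1_Z : g i' = c0 (g i) ->
      (g i, g i') \in bdG1 D <-> matrix_P1 m i i'.
    move=> gi'; rewrite matrix_P1_cut_matrix //; last by rewrite /q gi' posS.
    have -> : (g i, g i') \in bdG1 D = (g i' \notin Z).
      by rewrite inE negbK gi' permK.
    split=> [no_Z j le_j | no_cut]; last first.
      by apply/negP=> /cutsP[j /no_cut/eqP].
    by apply: contraNneq no_Z => qb; apply/cutsP; exists j.
  rewrite inG1 inGamma; split=> [inG | [P1i gi']]; last exact/G1_Z.
  have /properP[/subsetP/(_ _ inG)/imsetP[x _ [<- gi']] _] := bdG1_proper D.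
  by split=> //; apply/G1_Z.
- exists f; split=> //; first by exists g.
  by split=> x; rewrite ?C0E ?CEE fK.
Qed.

Theorem theorem5p3 (d : Order.disp_t) (S : finTBOrderType d) (p : nat)
    (cardS : #|S| = p.+1) (D : assoc_BD S)
    (compD : compatible (@order_lt d S) (bdC0 D)) :
  (exists (n : nat) (m : 'M[int]_(p.+1, n.+1)) (E : assoc_BD 'I_p.+1),
     [/\ condition_a m, condition_b m, matrix_BD m E
       & BD_isomorphic (@order_lt d S) D (prec m) E])
  <->
  (alpha0 S \notin bdG2 D /\
   exists k : int,
     coprimez k #|S|%:Z /\ bdC D = perm_zpow (bdC0 D) k).
Proof.
split=> [[n [m [E [ma mb mE isoE]]]] | [no_alpha0 [k [_ CE]]]]; last first.
  exact: BD_matrix CE.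
split; first exact: matrix_BD_alpha0 mE isoE.
have com := matrix_BD_commute cardS compD ma mb mE isoE.
have [k [cop_k CE]] := commute_transitive_cyclic_coprime \bot%O
  (@bdC0_cyclic _ D) (@bdC_cyclic _ D) com.
by exists k%:Z; rewrite /coprimez /gcdz.
Qed.
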